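(* Let $R$ be an exceptional prime ring, and let $A$ be a noncentral additive subgroup of $R$ (i.e. $A\not\subseteq Z(R)$). Suppose that $[A,I]\subseteq A$, where $I$ is a nonzero ideal of $R$. Then either $A$ contains a proper Lie ideal of $R$ or $AC=Ca+C$ for some $a\in A\setminus Z(R)$ with $a^2\in Z(R)$.
   Context: Rings are associative, not necessarily unital; $Z(R)$ is the center of $R$. $[a,b]:=ab-ba$; for additive subgroups $A,B$ of a ring, $AB$ (resp. $[A,B]$) is the additive subgroup generated by all $ab$ (resp. $[a,b]$), $a\in A$, $b\in B$. A Lie ideal of $R$ is called proper if it is of the form $[M,R]$ for some nonzero ideal $M$ of $R$. For a prime ring $R$, let $Q_s(R)$ be its Martindale symmetric ring of quotients and $C$ (the extended centroid) the center of $Q_s(R)$, which is a field; products such as $RC$, $AC$ are taken in $Q_s(R)$. A prime ring $R$ is called exceptional if both $\mathrm{char}\,R=2$ and $\dim_C RC=4$; in this case $RC$ is a central simple $C$-algebra (with $1$, so $C\subseteq RC$). *)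

(* Defs.v *)
From HB Require Import structures.
From mathcomp Require Import all_boot all_algebra.
From mathcomp Require Import boolp classical_sets.

Set Implicit Arguments.
Unset Strict Implicit.
Unset Printing Implicit Defensive.

Import GRing.Theory.
Local Open Scope classical_set_scope.
Local Open Scope ring_scope.
Local Open Scope quotient_scope.

Reserved Notation "x ** y" (at level 40, left associativity).

(** Associative rings, not necessarily unital. *)
HB.mixin Record Zmodule_isRng R of GRing.Zmodule R := {
  rngmul : R -> R -> R;
  rngmulA : associative rngmul;
  rngmulDl : left_distributive rngmul +%R;
  rngmulDr : right_distributive rngmul +%R
}.

#[short(type="rngType")]
HB.structure Definition Rng := {R of GRing.Zmodule R & Zmodule_isRng R}.

Notation "x ** y" := (rngmul x y) : ring_scope.

HB.mixin Record Rng_isPrime R of Rng R := {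
  rng_nontrivial : exists x : R, x != 0;
  rng_prime : forall a b : R, (forall x, a ** x ** b = 0) -> a = 0 \/ b = 0
}.

#[short(type="primeRngType")]
HB.structure Definition PrimeRng := {R of Rng R & Rng_isPrime R}.

Section AdditiveSubgroups.
Variable V : zmodType.

Definition additive_subgroup (A : set V) : Prop :=
  A 0 /\ forall x y, A x -> A y -> A (x - y).

Definition additive_span (S : set V) : set V := smallest additive_subgroup S.

Lemma additive_subgroupN (A : set V) x : additive_subgroup A -> A x -> A (- x).
Proof. by move=> [A0 AB] Ax; rewrite -[- x]add0r; apply: AB. Qed.

Lemma additive_subgroupD (A : set V) x y :
  additive_subgroup A -> A x -> A y -> A (x + y).
Proof.
move=> sA Ax Ay; rewrite -[y]opprK; apply: sA.2 => //.
exact: additive_subgroupN.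
Qed.

Lemma additive_span_subgroup (S : set V) : additive_subgroup (additive_span S).
Proof.
split=> [M [[M0 _] _] //|x y Sx Sy M MS].
by apply: MS.1.2; [apply: Sx|apply: Sy].
Qed.

End AdditiveSubgroups.

Section RngTheory.
Variable R : rngType.
Implicit Types (A B I L M : set R) (x y : R).

Definition rng_center : set R := [set z | forall x, z ** x = x ** z].

Definition rng_comm x y : R := x ** y - y ** x.

Definition comm_span A B : set R :=
  additive_span [set rng_comm a b | a in A & b in B].

Definition ideal I : Prop :=
  additive_subgroup I /\ forall r x, I x -> I (r ** x) /\ I (x ** r).

Definition nonzero_ideal I : Prop := ideal I /\ exists2 x, I x & x != 0.

Definition proper_lie_ideal L : Prop :=
  exists2 M, nonzero_ideal M & L = comm_span M setT.

(** n is the least positive integer with n R = 0. *)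
Definition rng_char_eq (n : nat) : Prop :=
  [/\ (0 < n)%N, forall x, x *+ n = 0
    & forall m : nat, (0 < m < n)%N -> exists x, x *+ m != 0].

Lemma rngmul0r x : 0 ** x = 0.
Proof. by apply: (addrI (0 ** x)); rewrite -rngmulDl !addr0. Qed.

Lemma rngmulr0 x : x ** 0 = 0.
Proof. by apply: (addrI (x ** 0)); rewrite -rngmulDr !addr0. Qed.

Lemma rngmulNr x y : (- x) ** y = - (x ** y).
Proof. by apply: (addrI (x ** y)); rewrite -rngmulDl !subrr rngmul0r. Qed.

Lemma rngmulrN x y : x ** (- y) = - (x ** y).
Proof. by apply: (addrI (x ** y)); rewrite -rngmulDr !subrr rngmulr0. Qed.

Lemma rngmulBl x y z : (x - y) ** z = x ** z - y ** z.
Proof. by rewrite rngmulDl rngmulNr. Qed.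

Lemma rngmulBr x y z : z ** (x - y) = z ** x - z ** y.
Proof. by rewrite rngmulDr rngmulrN. Qed.

End RngTheory.
Arguments rng_center : clear implicits.
Arguments rng_char_eq : clear implicits.

Section IdealProducts.
Variable R : primeRngType.
Implicit Types (I J K : set R).

Lemma nonzero_idealT : nonzero_ideal [set: R].
Proof. by split=> //; have [x x0] := @rng_nontrivial R; exists x. Qed.

Definition ideal_mul J I : set R :=
  additive_span [set y ** x | y in J & x in I].

Lemma ideal_mul_sub J I : ideal I -> ideal J -> ideal_mul J I `<=` J `&` I.
Proof.
move=> idI idJ; apply: smallest_sub.
  split=> [|x y [Jx Ix] [Jy Iy]]; first by split; [apply: idJ.1.1|apply: idI.1.1].
  by split; [apply: idJ.1.2|apply: idI.1.2].
by move=> _ [y Jy [x Ix <-]]; split; [apply: (idJ.2 _ _ Jy).2|apply: (idI.2 _ _ Ix).1].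
Qed.

Lemma ideal_mul_nonzero J I :
  nonzero_ideal I -> nonzero_ideal J -> nonzero_ideal (ideal_mul J I).
Proof.
move=> [idI [x Ix x0]] [idJ [y Jy y0]].
have sJI := additive_span_subgroup [set y ** x | y in J & x in I].
split.
  split=> // r z.
  move: z; apply: smallest_sub.
    split=> [|a b [ra ar] [rb br]] /=.
      by rewrite rngmul0r rngmulr0; split; apply: sJI.1.
    by rewrite rngmulBl rngmulBr; split; apply: sJI.2.
  move=> _ [b Jb [a Ia <-]] /=; split; apply: sub_gen_smallest.
    by exists (r ** b); [exact: (idJ.2 _ _ Jb).1|exists a => //; rewrite rngmulA].
  by exists b => //; exists (a ** r); [exact: (idI.2 _ _ Ia).2|rewrite rngmulA].
have [r yrx] : exists r, y ** r ** x <> 0.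
  apply/not_existsP => no.
  have : y = 0 \/ x = 0 by apply: rng_prime => r; apply: contrapT; apply: no.
  by case=> /eqP; apply/negP.
exists (y ** r ** x); last exact/eqP.
apply: sub_gen_smallest; exists (y ** r); first exact: (idJ.2 _ _ Jy).2.
by exists x.
Qed.

Lemma nonzero_idealI I J :
  nonzero_ideal I -> nonzero_ideal J -> nonzero_ideal (I `&` J).
Proof.
move=> nI nJ; have [_ [x JIx x0]] := ideal_mul_nonzero nI nJ.
have [idI idJ] := (nI.1, nJ.1).
split; last by exists x => //; have [] := ideal_mul_sub idI idJ JIx.
split; first split=> [|a b [Ia Ja] [Ib Jb]].
- by split; [apply: idI.1.1|apply: idJ.1.1].
- by split; [apply: idI.1.2|apply: idJ.1.2].
move=> r a [Ia Ja]; have [? ?] := idI.2 r a Ia; have [? ?] := idJ.2 r a Ja.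
by [].
Qed.

End IdealProducts.

(** The Martindale symmetric ring of quotients of a prime ring: classes of
    triples (I, f, g), with I a nonzero ideal, f : I -> R a morphism of right
    R-modules, g : I -> R a morphism of left R-modules and x f(y) = g(x) y for
    x, y in I.  The class q of (I, f, g) satisfies q x = f(x) and x q = g(x)
    for x in I.  The maps f, g are total functions whose values outside I are
    irrelevant: two triples are identified when they agree on some nonzero
    ideal contained in both domains. *)
Record symmult (R : rngType) := Symmult {
  sm_dom : set R;
  sm_l : R -> R;
  sm_r : R -> R;
  sm_domP : nonzero_ideal sm_dom;
  sm_lD : forall x y, sm_dom x -> sm_dom y -> sm_l (x + y) = sm_l x + sm_l y;
  sm_lM : forall x r, sm_dom x -> sm_l (x ** r) = sm_l x ** r;
  sm_rD : forall x y, sm_dom x -> sm_dom y -> sm_r (x + y) = sm_r x + sm_r y;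
  sm_rM : forall r x, sm_dom x -> sm_r (r ** x) = r ** sm_r x;
  sm_lr : forall x y, sm_dom x -> sm_dom y -> x ** sm_l y = sm_r x ** y
}.

HB.instance Definition _ (R : rngType) := gen_eqMixin (symmult R).
HB.instance Definition _ (R : rngType) := gen_choiceMixin (symmult R).

Section SymmetricQuotients.
Variable R : primeRngType.
Implicit Types (p q s : symmult R).

Definition symmult_agree p q : Prop :=
  exists2 K, nonzero_ideal K & forall x, K x ->
    [/\ sm_dom p x, sm_dom q x, sm_l p x = sm_l q x & sm_r p x = sm_r q x].

Definition symmult_eqb p q : bool := `[< symmult_agree p q >].

Lemma symmult_eqb_equiv : equiv_class_of symmult_eqb.
Proof.
split=> [p|p q|q p s].
- by apply/asboolP; exists (sm_dom p) => //; apply: sm_domP.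
- by apply/asboolP/asboolP => -[K nK KP]; exists K => // x /KP[].
- move=> /asboolP[K nK KP] /asboolP[L nL LP]; apply/asboolP.
  exists (K `&` L); first exact: nonzero_idealI.
  by move=> x [/KP[? ? -> ->] /LP[]].
Qed.

Canonical symmult_equiv := EquivRelPack symmult_eqb_equiv.

Lemma sm_l0 p : sm_l p 0 = 0.
Proof.
have p0 : sm_dom p 0 by apply: (sm_domP p).1.1.1.
by apply: (addrI (sm_l p 0)); rewrite -sm_lD // !addr0.
Qed.

Lemma sm_r0 p : sm_r p 0 = 0.
Proof.
have p0 : sm_dom p 0 by apply: (sm_domP p).1.1.1.
by apply: (addrI (sm_r p 0)); rewrite -sm_rD // !addr0.
Qed.

Lemma sm_lB p x y : sm_dom p x -> sm_dom p y -> sm_l p (x - y) = sm_l p x - sm_l p y.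
Proof.
move=> px py; have pN := additive_subgroupN (sm_domP p).1.1 py.
rewrite sm_lD //; congr (_ + _).
by apply: (addrI (sm_l p y)); rewrite -sm_lD // !subrr sm_l0.
Qed.

Lemma sm_rB p x y : sm_dom p x -> sm_dom p y -> sm_r p (x - y) = sm_r p x - sm_r p y.
Proof.
move=> px py; have pN := additive_subgroupN (sm_domP p).1.1 py.
rewrite sm_rD //; congr (_ + _).
by apply: (addrI (sm_r p y)); rewrite -sm_rD // !subrr sm_r0.
Qed.

Local Obligation Tactic := cbn beta.

Program Definition sm_zero : symmult R :=
  @Symmult R setT (fun=> 0) (fun=> 0) _ _ _ _ _ _.
Next Obligation. exact: nonzero_idealT. Qed.
Next Obligation. by move=> *; rewrite addr0. Qed.
Next Obligation. by move=> *; rewrite rngmul0r. Qed.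
Next Obligation. by move=> *; rewrite addr0. Qed.
Next Obligation. by move=> *; rewrite rngmulr0. Qed.
Next Obligation. by move=> *; rewrite rngmulr0 rngmul0r. Qed.

Program Definition sm_one : symmult R :=
  @Symmult R setT id id _ _ _ _ _ _.
Next Obligation. exact: nonzero_idealT. Qed.
Next Obligation. by []. Qed.
Next Obligation. by []. Qed.
Next Obligation. by []. Qed.
Next Obligation. by []. Qed.
Next Obligation. by []. Qed.

Program Definition sm_opp p : symmult R :=
  @Symmult R (sm_dom p) (fun x => - sm_l p x) (fun x => - sm_r p x) _ _ _ _ _ _.
Next Obligation. by move=> p; exact: (sm_domP p). Qed.
Next Obligation. by move=> p x y px py; rewrite sm_lD // opprD. Qed.
Next Obligation. by move=> p x r px; rewrite sm_lM // rngmulNr. Qed.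
Next Obligation. by move=> p x y px py; rewrite sm_rD // opprD. Qed.
Next Obligation. by move=> p r x px; rewrite sm_rM // rngmulrN. Qed.
Next Obligation. by move=> p x y px py; rewrite rngmulrN rngmulNr sm_lr. Qed.

Program Definition sm_add p q : symmult R :=
  @Symmult R (sm_dom p `&` sm_dom q) (fun x => sm_l p x + sm_l q x)
    (fun x => sm_r p x + sm_r q x) _ _ _ _ _ _.
Next Obligation. by move=> p q; apply: nonzero_idealI; apply: sm_domP. Qed.
Next Obligation. by move=> p q x y [? ?] [? ?]; rewrite !sm_lD // addrACA. Qed.
Next Obligation. by move=> p q x r [? ?]; rewrite !sm_lM // rngmulDl. Qed.
Next Obligation. by move=> p q x y [? ?] [? ?]; rewrite !sm_rD // addrACA. Qed.
Next Obligation. by move=> p q r x [? ?]; rewrite !sm_rM // rngmulDr. Qed.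
Next Obligation.
by move=> p q x y [? ?] [? ?]; rewrite rngmulDr rngmulDl !sm_lr.
Qed.

Lemma sm_mul_dom p q x : ideal_mul (sm_dom q) (sm_dom p) x ->
  [/\ sm_dom p x, sm_dom q x, sm_dom p (sm_l q x) & sm_dom q (sm_r p x)].
Proof.
have [pI qI] := ((sm_domP p).1, (sm_domP q).1).
move: x; apply: smallest_sub.
  split=> [|x y [px qx plx qrx] [py qy ply qry]].
    by rewrite sm_l0 sm_r0; split; first [exact: pI.1.1|exact: qI.1.1].
  by rewrite sm_lB // sm_rB //; split; first [exact: pI.1.2|exact: qI.1.2].
move=> _ [y qy [x px <-]]; rewrite sm_lM // sm_rM //.
by split; first [exact: (pI.2 _ _ _).1|exact: (qI.2 _ _ _).2].
Qed.

Program Definition sm_mul p q : symmult R :=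
  @Symmult R (ideal_mul (sm_dom q) (sm_dom p)) (fun x => sm_l p (sm_l q x))
    (fun x => sm_r q (sm_r p x)) _ _ _ _ _ _.
Next Obligation. by move=> p q; apply: ideal_mul_nonzero; apply: sm_domP. Qed.
Next Obligation.
by move=> p q x y /sm_mul_dom[? ? ? ?] /sm_mul_dom[? ? ? ?]; rewrite !sm_lD.
Qed.
Next Obligation. by move=> p q x r /sm_mul_dom[? ? ? ?]; rewrite !sm_lM. Qed.
Next Obligation.
by move=> p q x y /sm_mul_dom[? ? ? ?] /sm_mul_dom[? ? ? ?]; rewrite !sm_rD.
Qed.
Next Obligation. by move=> p q r x /sm_mul_dom[? ? ? ?]; rewrite !sm_rM. Qed.
Next Obligation.
by move=> p q x y /sm_mul_dom[? ? ? ?] /sm_mul_dom[? ? ? ?]; rewrite !sm_lr.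
Qed.

Program Definition sm_const (a : R) : symmult R :=
  @Symmult R setT (fun x => a ** x) (fun x => x ** a) _ _ _ _ _ _.
Next Obligation. by move=> a; exact: nonzero_idealT. Qed.
Next Obligation. by move=> a x y _ _; rewrite rngmulDr. Qed.
Next Obligation. by move=> a x r _; rewrite rngmulA. Qed.
Next Obligation. by move=> a x y _ _; rewrite rngmulDl. Qed.
Next Obligation. by move=> a r x _; rewrite rngmulA. Qed.
Next Obligation. by move=> a x y _ _; rewrite rngmulA. Qed.

Definition Qs : Type := {eq_quot symmult_equiv}.

HB.instance Definition _ := Choice.on Qs.
HB.instance Definition _ := EqQuotient.on Qs.

Lemma Qs_eqP p q : symmult_agree p q <-> \pi_Qs p = \pi_Qs q.
Proof.
by split=> [pq|/eqmodP/asboolP//]; apply/eqmodP; apply/asboolP.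
Qed.

Lemma Qs_eq p q :
    (forall x, sm_dom p x -> sm_dom q x ->
      sm_l p x = sm_l q x /\ sm_r p x = sm_r q x) ->
  \pi_Qs p = \pi_Qs q.
Proof.
move=> pq; apply/Qs_eqP; exists (sm_dom p `&` sm_dom q).
  by apply: nonzero_idealI; apply: sm_domP.
by move=> x [px qx]; have [] := pq x px qx.
Qed.

Definition Qs_opp (a : Qs) : Qs := \pi_Qs (sm_opp (repr a)).
Definition Qs_add (a b : Qs) : Qs := \pi_Qs (sm_add (repr a) (repr b)).
Definition Qs_mul (a b : Qs) : Qs := \pi_Qs (sm_mul (repr a) (repr b)).

Lemma pi_reprE p : symmult_agree (repr (\pi_Qs p)) p.
Proof. by apply/Qs_eqP; rewrite reprK. Qed.

Lemma Qs_oppE p : Qs_opp (\pi_Qs p) = \pi_Qs (sm_opp p).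
Proof.
have [K nK KP] := pi_reprE p; apply/Qs_eqP; exists K => // x /KP[? ? ll rr] /=.
by rewrite ll rr.
Qed.

Lemma Qs_addE p q : Qs_add (\pi_Qs p) (\pi_Qs q) = \pi_Qs (sm_add p q).
Proof.
have [[K nK KP] [L nL LP]] := (pi_reprE p, pi_reprE q).
apply/Qs_eqP; exists (K `&` L); first exact: nonzero_idealI.
by move=> x [/KP[? ? ll rr] /LP[? ? ll' rr']] /=; rewrite ll rr ll' rr'.
Qed.

Lemma Qs_mulE p q : Qs_mul (\pi_Qs p) (\pi_Qs q) = \pi_Qs (sm_mul p q).
Proof.
have [[K nK KP] [L nL LP]] := (pi_reprE p, pi_reprE q).
set p' := repr (\pi_Qs p); set q' := repr (\pi_Qs q).
rewrite -/p' -/q' in KP LP *.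
have [idK idL] := (nK.1, nL.1).
apply/Qs_eqP; exists (ideal_mul L K); first exact: ideal_mul_nonzero.
have K' : K `<=` sm_dom p' by move=> z /KP[].
have L' : L `<=` sm_dom q' by move=> z /LP[].
have Kp : K `<=` sm_dom p by move=> z /KP[].
have Lq : L `<=` sm_dom q by move=> z /LP[].
have mono (u v : symmult R) : K `<=` sm_dom u -> L `<=` sm_dom v ->
    ideal_mul L K `<=` ideal_mul (sm_dom v) (sm_dom u).
  move=> Ku Lv; apply: sub_smallest2r; first exact: additive_span_subgroup.
  by move=> _ [b Lb [a Ka <-]]; exists b; [exact: Lv|exists a => //; exact: Ku].
move=> x LKx.
have [Kx Lx Klq Lrp] : [/\ K x, L x, K (sm_l q x) & L (sm_r p x)].
  move: x LKx; apply: smallest_sub.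
    split=> [|x y [Kx Lx Kl Lr] [Ky Ly Kl' Lr']].
      by rewrite sm_l0 sm_r0; split; first [exact: idK.1.1|exact: idL.1.1].
    rewrite sm_lB ?sm_rB; [|exact: Kp|exact: Kp|exact: Lq|exact: Lq].
    by split; first [exact: idK.1.2|exact: idL.1.2].
  move=> _ [b Lb [a Ka <-]]; rewrite sm_lM ?sm_rM; [|exact: Kp|exact: Lq].
  by split; first [exact: (idK.2 _ _ _).1|exact: (idL.2 _ _ _).2].
have [_ _ _ rx] := KP x Kx; have [_ _ lx _] := LP x Lx.
have [_ _ llx _] := KP _ Klq; have [_ _ _ rrx] := LP _ Lrp.
by split=> /=; [exact: mono|exact: mono|rewrite lx llx|rewrite rx rrx].
Qed.

Lemma Qs_ind (P : Qs -> Prop) : (forall p, P (\pi_Qs p)) -> forall a, P a.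
Proof. by move=> Ppi a; rewrite -[a]reprK. Qed.

Lemma Qs_addA : associative Qs_add.
Proof.
elim/Qs_ind=> p; elim/Qs_ind=> q; elim/Qs_ind=> s; rewrite !Qs_addE.
by apply: Qs_eq => x _ _ /=; rewrite !addrA.
Qed.

Lemma Qs_addC : commutative Qs_add.
Proof.
elim/Qs_ind=> p; elim/Qs_ind=> q; rewrite !Qs_addE.
by apply: Qs_eq => x _ _ /=; split; rewrite addrC.
Qed.

Lemma Qs_add0 : left_id (\pi_Qs sm_zero) Qs_add.
Proof.
elim/Qs_ind=> p; rewrite !Qs_addE.
by apply: Qs_eq => x _ _ /=; rewrite !add0r.
Qed.

Lemma Qs_addN : left_inverse (\pi_Qs sm_zero) Qs_opp Qs_add.
Proof.
elim/Qs_ind=> p; rewrite Qs_oppE Qs_addE.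
by apply: Qs_eq => x _ _ /=; rewrite !addNr.
Qed.

HB.instance Definition _ :=
  GRing.isZmodule.Build Qs Qs_addA Qs_addC Qs_add0 Qs_addN.

Lemma Qs_mulA : associative Qs_mul.
Proof.
elim/Qs_ind=> p; elim/Qs_ind=> q; elim/Qs_ind=> s; rewrite !Qs_mulE.
by apply: Qs_eq => x _ _ /=.
Qed.

Lemma Qs_mul1 : left_id (\pi_Qs sm_one) Qs_mul.
Proof. by elim/Qs_ind=> p; rewrite Qs_mulE; apply: Qs_eq. Qed.

Lemma Qs_mulr1 : right_id (\pi_Qs sm_one) Qs_mul.
Proof. by elim/Qs_ind=> p; rewrite Qs_mulE; apply: Qs_eq. Qed.

Lemma Qs_mulDl : left_distributive Qs_mul Qs_add.
Proof.
elim/Qs_ind=> p; elim/Qs_ind=> q; elim/Qs_ind=> s; rewrite !(Qs_addE, Qs_mulE).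
apply: Qs_eq => x /sm_mul_dom[_ _ _ /=].
by move=> cD [/sm_mul_dom[_ _ _ ?] /sm_mul_dom[_ _ _ ?]]; rewrite sm_rD.
Qed.

Lemma Qs_mulDr : right_distributive Qs_mul Qs_add.
Proof.
elim/Qs_ind=> p; elim/Qs_ind=> q; elim/Qs_ind=> s; rewrite !(Qs_addE, Qs_mulE).
apply: Qs_eq => x _ /=.
by move=> [/sm_mul_dom[_ _ ? _] /sm_mul_dom[_ _ ? _]]; rewrite sm_lD.
Qed.

Lemma Qs_one_neq0 : \pi_Qs sm_one != 0.
Proof.
apply/eqP => /Qs_eqP[K [_ [x Kx x0]] /(_ x Kx)[_ _ /= x1 _]].
by rewrite x1 eqxx in x0.
Qed.

HB.instance Definition _ :=
  GRing.Zmodule_isNzRing.Build Qs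
    Qs_mulA Qs_mul1 Qs_mulr1 Qs_mulDl Qs_mulDr Qs_one_neq0.

Definition Qs_emb (a : R) : Qs := \pi_Qs (sm_const a).

Lemma Qs_emb_add a b : Qs_emb (a + b) = Qs_emb a + Qs_emb b.
Proof.
apply/esym; rewrite /Qs_emb /GRing.add /= Qs_addE.
by apply: Qs_eq => x _ _ /=; rewrite rngmulDl rngmulDr.
Qed.

Lemma Qs_emb_mul a b : Qs_emb (a ** b) = Qs_emb a * Qs_emb b.
Proof.
apply/esym; rewrite /Qs_emb /GRing.mul /= Qs_mulE.
by apply: Qs_eq => x _ _ /=; rewrite !rngmulA.
Qed.

Lemma nonzero_ideal_annr K (a : R) :
  nonzero_ideal K -> (forall x, K x -> a ** x = 0) -> a = 0.
Proof.
move=> [idK [x Kx x0]] aK; have [//|x0'] : a = 0 \/ x = 0; last first.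
  by rewrite x0' eqxx in x0.
by apply: rng_prime => r; rewrite -rngmulA; apply: aK; apply: (idK.2 _ _ Kx).1.
Qed.

Lemma Qs_emb_inj : injective Qs_emb.
Proof.
move=> a b /Qs_eqP[K nK KP]; apply/eqP; rewrite -subr_eq0; apply/eqP.
apply: (nonzero_ideal_annr nK) => x /KP[_ _ /= ax _].
by rewrite rngmulBl ax subrr.
Qed.

Lemma Qs_mul_emb p x :
  sm_dom p x -> \pi_Qs p * Qs_emb x = Qs_emb (sm_l p x).
Proof.
move=> px; rewrite /Qs_emb /GRing.mul /= Qs_mulE.
by apply: Qs_eq => y /sm_mul_dom[py _ _ _] _ /=; rewrite sm_lM // sm_lr.
Qed.

Lemma Qs_emb_mul_l p x :
  sm_dom p x -> Qs_emb x * \pi_Qs p = Qs_emb (sm_r p x).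
Proof.
move=> px; rewrite /Qs_emb /GRing.mul /= Qs_mulE.
by apply: Qs_eq => y /sm_mul_dom[_ py _ _] _ /=; rewrite sm_rM // sm_lr.
Qed.

Definition extended_centroid : set Qs := [set c | forall q : Qs, c * q = q * c].

Definition Qs_mul_span (A B : set Qs) : set Qs :=
  additive_span [set a * b | a in A & b in B].

(** For A a subset of R, this is AC, with R embedded in Q_s(R). *)
Definition central_span (A : set R) : set Qs :=
  Qs_mul_span (Qs_emb @` A) extended_centroid.

(** The C-subspace W of Q_s(R) has dimension n over C: it has a basis of n
    vectors. *)
Definition dim_over_C (W : set Qs) (n : nat) : Prop :=
  exists b : 'I_n -> Qs,
    [/\ W = [set q | exists2 c : 'I_n -> Qs,
               (forall i, extended_centroid (c i)) & q = \sum_i c i * b i]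
      & forall c : 'I_n -> Qs, (forall i, extended_centroid (c i)) ->
          \sum_i c i * b i = 0 -> forall i, c i = 0].

Definition exceptional : Prop :=
  rng_char_eq R 2 /\ dim_over_C (central_span setT) 4.

End SymmetricQuotients.
Arguments Qs : clear implicits.
Arguments extended_centroid : clear implicits.
Arguments exceptional : clear implicits.

(* Main.v *)
(** If [a, b] <> 0 for some a, b in A, then {x | [x, I] <= A} is a subring
    containing A (because [xy, z] = [x, yz] + [y, zx]), hence contains the
    nonzero ideal M = I[a, b]I, and [M M, R] <= [M, I] <= A.

    If A is commutative, fix a in A noncentral.  For x in I we have
    [a, [a, x]] = 0, which in characteristic 2 says [a^2, x] = 0, so a^2 is
    central.  For b in A, [b, [a, x]] = 0 for all x in I yields
    [a, x]z[b, y] + [b, x]z[a, y] = 0, so that [b, x] = c[a, x] for some c in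
    C, by Martindale's argument, and b - ca is in C.  Finally, since a^2 is
    central, some [a, x] is not in Ca; as [a, x] is in A, it is of the form
    la + m with m in C nonzero, whence C <= AC. *)

Require Import Defs.
From HB Require Import structures.
From mathcomp Require Import all_boot all_algebra.
From mathcomp Require Import boolp classical_sets.

Set Implicit Arguments.
Unset Strict Implicit.
Unset Printing Implicit Defensive.

Import GRing.Theory.
Local Open Scope classical_set_scope.
Local Open Scope ring_scope.

(** * Commutator identities, and the subring of elements whose commutators with [I] lie in [A] *)

Section Commutators.
Variable R : rngType.
Implicit Types (A I : set R) (a b x y z : R).

Lemma rng_commMr a x y :
  rng_comm a (x ** y) = rng_comm a x ** y + x ** rng_comm a y.
Proof. by rewrite /rng_comm rngmulBl rngmulBr !rngmulA addrA subrK. Qed.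

Lemma rng_commMl x y z :
  rng_comm (x ** y) z = rng_comm x (y ** z) + rng_comm y (z ** x).
Proof. by rewrite /rng_comm !rngmulA addrA subrK. Qed.

Lemma rng_commDl x y z : rng_comm (x + y) z = rng_comm x z + rng_comm y z.
Proof. by rewrite /rng_comm rngmulDl rngmulDr opprD addrACA. Qed.

Lemma rng_commNl x z : rng_comm (- x) z = - rng_comm x z.
Proof. by rewrite /rng_comm rngmulNr rngmulrN opprD. Qed.

Lemma rng_comm0l z : rng_comm 0 z = 0.
Proof. by rewrite /rng_comm rngmul0r rngmulr0 subrr. Qed.

Lemma rng_commBl x y z : rng_comm (x - y) z = rng_comm x z - rng_comm y z.
Proof. by rewrite rng_commDl rng_commNl. Qed.

Lemma rng_commN x y : - rng_comm x y = rng_comm y x.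
Proof. by rewrite /rng_comm opprB. Qed.

Lemma rng_comm_eq0 x y : rng_comm x y = 0 <-> x ** y = y ** x.
Proof. by rewrite /rng_comm; split=> [/eqP|->]; rewrite ?subrr // subr_eq0 => /eqP. Qed.

Lemma comm_spanP A I L : additive_subgroup L ->
  (comm_span A I `<=` L) <-> (forall a x, A a -> I x -> L (rng_comm a x)).
Proof.
move=> sL; split=> [AIL a x Aa Ix|AIL].
  by apply: AIL; apply: sub_gen_smallest; exists a => //; exists x.
by apply: smallest_sub => // _ [a Aa [x Ix <-]]; apply: AIL.
Qed.

Definition comm_transporter I A : set R :=
  [set x | forall y, I y -> A (rng_comm x y)].

Lemma comm_transporter_subgroup I A :
  additive_subgroup A -> additive_subgroup (comm_transporter I A).
Proof.
move=> sA; split=> [y _|x y Tx Ty z Iz]; first by rewrite rng_comm0l; exact: sA.1.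
by rewrite rng_commBl; apply: sA.2; [exact: Tx|exact: Ty].
Qed.

Lemma comm_transporterM I A x y : additive_subgroup A -> ideal I ->
  comm_transporter I A x -> comm_transporter I A y -> comm_transporter I A (x ** y).
Proof.
move=> sA idI Tx Ty z Iz; rewrite rng_commMl; apply: additive_subgroupD => //.
  by apply: Tx; exact: (idI.2 _ _ Iz).1.
by apply: Ty; exact: (idI.2 _ _ Iz).2.
Qed.

(* [[a, b]x = [a, bx] - b[a, x]], and [y([a, b]x) = ([a, b]x)y - [[a, b]x, y]]. *)
Lemma comm_transporter_comm A I a b x y : additive_subgroup A -> ideal I ->
    (forall a x, A a -> I x -> A (rng_comm a x)) ->
  A a -> A b -> I x -> I y -> comm_transporter I A (y ** rng_comm a b ** x).
Proof.
move=> sA idI AI Aa Ab Ix Iy.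
have sT := comm_transporter_subgroup I sA.
have AT : A `<=` comm_transporter I A by move=> c Ac z; exact: AI.
have Tr z : I z -> comm_transporter I A (rng_comm a b ** z).
  move=> Iz; rewrite -[_ ** z](addrK (b ** rng_comm a z)) -rng_commMr.
  apply: sT.2; first by apply: AT; apply: AI => //; exact: (idI.2 _ _ Iz).1.
  by apply: comm_transporterM => //; apply: AT => //; exact: AI.
rewrite -rngmulA -[y ** _](subKr (rng_comm a b ** x ** y)).
apply: sT.2; first by rewrite -rngmulA; apply: Tr; exact: (idI.2 _ _ Ix).2.
by apply: AT; exact: Tr.
Qed.

End Commutators.

(** * Primeness tested on a nonzero ideal, and the case of noncommuting elements in [A] *)

Section PrimeRings.
Variable R : primeRngType.
Implicit Types (A I J : set R) (a b x y z : R).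

Lemma ideal_prime I a b : nonzero_ideal I ->
  (forall x, I x -> a ** x ** b = 0) -> a = 0 \/ b = 0.
Proof.
move=> nI aIb; have [->|b0] := EM (b = 0); [by right|left].
apply: (nonzero_ideal_annr nI) => x Ix; have [//|//] : a ** x = 0 \/ b = 0.
by apply: rng_prime => s; rewrite -(rngmulA a); apply: aIb; exact: (nI.1.2 _ _ Ix).2.
Qed.

(** For [x] in [I], expanding [[a, rx]] leaves [[a, r]x = 0], so [[a, r]] annihilates [I] from the
    left. *)
Lemma ideal_centralizer I a : nonzero_ideal I ->
  (forall x, I x -> rng_comm a x = 0) -> rng_center R a.
Proof.
move=> nI aI r; apply/rng_comm_eq0.
apply: (nonzero_ideal_annr nI) => x Ix.
have := aI (r ** x) (nI.1.2 _ _ Ix).1.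
by rewrite rng_commMr (aI x) // rngmulr0 addr0.
Qed.

Definition ideal_gen_mid I a : set R :=
  additive_span [set w | exists y x, [/\ I y, I x & w = y ** a ** x]].

Lemma ideal_gen_mid_nonzero I a : nonzero_ideal I -> a != 0 ->
  nonzero_ideal (ideal_gen_mid I a).
Proof.
move=> nI a0; have idI := nI.1; have sM := additive_span_subgroup
  [set w | exists y x, [/\ I y, I x & w = y ** a ** x]].
have MI y x : I y -> I x -> ideal_gen_mid I a (y ** a ** x).
  by move=> Iy Ix; apply: sub_gen_smallest; exists y, x.
split; [split=> // r z; move: z; apply: smallest_sub|].
- split=> [|z w [rz zr] [rw wr]] /=; first by rewrite rngmul0r rngmulr0; split; apply: sM.1.
  by rewrite rngmulBl rngmulBr; split; apply: sM.2.
- move=> _ [y [x [Iy Ix ->]]] /=; split.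
    by rewrite !rngmulA; apply: MI => //; exact: (idI.2 _ _ Iy).1.
  by rewrite -rngmulA; apply: MI => //; exact: (idI.2 _ _ Ix).2.
(* If every [y a x] vanished, then [y z a] would annihilate [I] for all [z] in [I], and primeness on
   [I] with [y != 0] would force [a = 0]. *)
apply: contrapT => M0.
have yax y x : I y -> I x -> y ** a ** x = 0.
  move=> Iy Ix; apply: contrapT => /eqP ne; apply: M0.
  by exists (y ** a ** x) => //; exact: MI.
have [_ [y Iy y0]] := nI.
suff : y = 0 \/ a = 0 by case=> e; [move: y0|move: a0]; rewrite e eqxx.
apply: (ideal_prime nI) => z Iz; apply: (nonzero_ideal_annr nI) => x Ix.
by apply: yax => //; exact: (idI.2 _ _ Iz).1.
Qed.

Lemma noncommutative_contains_proper_lie_ideal A I a b :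
    additive_subgroup A -> nonzero_ideal I ->
    (forall a x, A a -> I x -> A (rng_comm a x)) ->
    A a -> A b -> rng_comm a b != 0 ->
  exists2 L : set R, proper_lie_ideal L & L `<=` A.
Proof.
move=> sA nI AI Aa Ab ab0.
have nM := ideal_gen_mid_nonzero nI ab0; set M := ideal_gen_mid _ _ in nM.
have MT : M `<=` comm_transporter I A.
  apply: smallest_sub; first exact: comm_transporter_subgroup.
  by move=> _ [y [x [Iy Ix ->]]]; apply: comm_transporter_comm => //; exact: nI.1.
have MI : M `<=` I.
  apply: smallest_sub; first exact: nI.1.1.
  by move=> _ [y [x [Iy Ix ->]]]; exact: (nI.1.2 _ _ Ix).1.
exists (comm_span (ideal_mul M M) setT).
  by exists (ideal_mul M M) => //; exact: ideal_mul_nonzero.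
apply/comm_spanP => // m r mM _; move: m mM.
suff : ideal_mul M M `<=` comm_transporter setT A by move=> h m /h; apply.
apply: smallest_sub; first exact: comm_transporter_subgroup.
(* The factor [s] is arbitrary in [R], but [[yx, s] = [y, xs] + [x, sy]] absorbs it into [M], hence
   into [I], where the transporter applies. *)
move=> _ [y My [x Mx <-]] s _; rewrite rng_commMl; apply: additive_subgroupD => //.
  by apply: MT => //; apply: MI; exact: (nM.1.2 _ _ Mx).2.
by apply: MT => //; apply: MI; exact: (nM.1.2 _ _ My).1.
Qed.

(** * The extended centroid: detecting its elements, constructing them, and inverting them *)

Local Notation C := (extended_centroid R).
Local Notation emb := (@Qs_emb R).

Lemma Qs_emb0 : emb 0 = 0.
Proof. by apply: (addrI (emb 0)); rewrite -Qs_emb_add !addr0. Qed.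

Lemma Qs_embN x : emb (- x) = - emb x.
Proof. by apply: (addrI (emb x)); rewrite -Qs_emb_add !subrr Qs_emb0. Qed.

Lemma Qs_embB x y : emb (x - y) = emb x - emb y.
Proof. by rewrite Qs_emb_add Qs_embN. Qed.

Lemma Qs_emb_comm x y : emb (rng_comm x y) = emb x * emb y - emb y * emb x.
Proof. by rewrite Qs_embB !Qs_emb_mul. Qed.

(** The hypothesis kills the left map on [I] intersected with the domain; the balance
    [x f(y) = g(x) y] then kills the right map there too. *)
Lemma Qs_annr I (q : Qs R) : nonzero_ideal I ->
  (forall x, I x -> q * emb x = 0) -> q = 0.
Proof.
elim/Qs_ind: q => p nI pI.
have nJ := nonzero_idealI nI (sm_domP p).
have lp x : I x -> sm_dom p x -> sm_l p x = 0.
  move=> Ix px; apply: Qs_emb_inj.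
  by rewrite Qs_emb0 -(pI x Ix) Qs_mul_emb.
apply/Qs_eqP; exists (I `&` sm_dom p) => // x [Ix px]; split=> //=; first exact: lp.
apply: (nonzero_ideal_annr nJ) => y [Iy py].
by rewrite -sm_lr // lp // rngmulr0.
Qed.

(** If [s] has left map [f], then for [t] in its domain and [x] in [I] both [q s] and [s q] send
    [t x] to [f(t) x q], because [t x] and [f(t) x] lie in [I]. *)
Lemma extended_centroid_ideal I (q : Qs R) : nonzero_ideal I ->
  (forall x, I x -> q * emb x = emb x * q) -> C q.
Proof.
move=> nI qI s; apply/eqP; rewrite -subr_eq0; apply/eqP.
elim/Qs_ind: s => p; apply: (Qs_annr (sm_domP p)) => t pt.
apply: (Qs_annr nI) => x Ix.
have ptx := ((sm_domP p).1.2 x _ pt).2.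
have Itx := (nI.1.2 t _ Ix).1; have Iptx := (nI.1.2 (sm_l p t) _ Ix).1.
rewrite -mulrA -Qs_emb_mul mulrBl -!mulrA Qs_mul_emb // sm_lM // !qI //.
by rewrite mulrA Qs_mul_emb // sm_lM // subrr.
Qed.

(* [G] is the graph of a bimodule map from a nonzero ideal to [R]. *)
Lemma extended_centroid_graph (G : R -> R -> Prop) :
    G 0 0 -> (forall u v u' v', G u v -> G u' v' -> G (u - u') (v - v')) ->
    (forall r u v, G u v -> G (r ** u) (r ** v)) ->
    (forall r u v, G u v -> G (u ** r) (v ** r)) ->
    (forall v, G 0 v -> v = 0) -> (exists u v, G u v /\ u != 0) ->
  exists2 c, C c & forall u v, G u v -> c * emb u = emb v.
Proof.
move=> G0 GB Gl Gr Gfun [u0 [v0 [G00 u00]]].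
pose D := [set u | exists v, G u v].
have Guniq u v w : G u v -> G u w -> v = w.
  move=> Guv Guw; apply/eqP; rewrite -subr_eq0; apply/eqP.
  by apply: Gfun; rewrite -(subrr u); apply: GB.
have [f fP] : exists f : R -> R, forall u, D u -> G u (f u).
  have /choice[f fP] : forall u, exists v, D u -> G u v.
    by move=> u; have [[v Guv]|nDu] := EM (D u); [exists v|exists 0].
  by exists f.
have fE u v : G u v -> f u = v.
  by move=> Guv; apply: (Guniq _ _ _ (fP u _) Guv); exists v.
have GD u v u' v' : G u v -> G u' v' -> G (u + u') (v + v').
  move=> Guv Guv'; rewrite -[u']opprK -[v']opprK; apply: (GB) => //.
  by rewrite -sub0r -[- v']sub0r; apply: GB.
have nD : nonzero_ideal D.
  split; last by exists u0 => //; exists v0.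
  split.
    by split=> [|u u' [v ?] [v' ?]]; [exists 0|exists (v - v'); apply: GB].
  by move=> r u [v ?]; split; [exists (r ** v); exact: Gl|exists (v ** r); exact: Gr].
have fD x y : D x -> D y -> f (x + y) = f x + f y.
  by move=> /fP ? /fP ?; apply: fE; exact: GD.
have fl x r : D x -> f (x ** r) = f x ** r by move=> /fP ?; apply: fE; exact: Gr.
have fr r x : D x -> f (r ** x) = r ** f x by move=> /fP ?; apply: fE; exact: Gl.
have flr x y : D x -> D y -> x ** f y = f x ** y by move=> Dx Dy; rewrite -fr // fl.
(* The same [f] serves as left and right map, so [c] commutes with [D]. *)
pose c := \pi_(Qs R)%qT (Symmult nD fD fl fD fr flr).
exists c.
  apply: (extended_centroid_ideal nD) => x Dx.
  by rewrite Qs_mul_emb // Qs_emb_mul_l.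
by move=> u v Guv; rewrite Qs_mul_emb /= ?(fE _ _ Guv) //; exists v.
Qed.

Lemma extended_centroidM (c d : Qs R) : C c -> C d -> C (c * d).
Proof. by move=> Cc Cd q; rewrite -mulrA Cd mulrA Cc mulrA. Qed.

Lemma extended_centroid_subgroup : additive_subgroup C.
Proof.
split=> [q|c d Cc Cd q]; first by rewrite mul0r mulr0.
by rewrite mulrBl mulrBr Cc Cd.
Qed.

(** Multiplication by [c] is injective on [R]: if [c v = 0], then [v r (c x) = 0] for all [r] and
    all [x] in the domain of [c], and primeness applies. The relation [u = c v] is therefore the
    graph of a bimodule map, which is the inverse. *)
Lemma extended_centroid_inv (c : Qs R) : C c -> c != 0 -> exists2 d, C d & d * c = 1.
Proof.
move=> Cc c0.
have cann v : c * emb v = 0 -> v = 0.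
  move=> cv; apply: contrapT => v0; move/eqP: c0; apply.
  elim/Qs_ind: c Cc cv => p Cp pv.
  apply: (Qs_annr (sm_domP p)) => x px; rewrite Qs_mul_emb //.
  have [//|->] : v = 0 \/ sm_l p x = 0; last exact: Qs_emb0.
  apply: rng_prime => r; apply: Qs_emb_inj.
  by rewrite !Qs_emb_mul -(Qs_mul_emb px) !mulrA -!Cp !mulrA pv !mul0r Qs_emb0.
have [d Cd dP] : exists2 d, C d & forall u v, emb u = c * emb v -> d * emb u = emb v.
  apply: (extended_centroid_graph (G := fun u v => emb u = c * emb v)).
  - by rewrite Qs_emb0 mulr0.
  - by move=> u v u' v' uv uv'; rewrite !Qs_embB uv uv' mulrBr.
  - by move=> r u v uv; rewrite !Qs_emb_mul uv !mulrA Cc.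
  - by move=> r u v uv; rewrite !Qs_emb_mul uv !mulrA.
  - by move=> v; rewrite Qs_emb0 => /esym; exact: cann.
  elim/Qs_ind: c Cc c0 cann => p Cp p0 cann.
  have [x Kx x0] := (sm_domP p).2.
  exists (sm_l p x), x; split; first by rewrite Qs_mul_emb.
  apply/eqP => lx0; move/eqP: x0; apply; apply: cann.
  by rewrite Qs_mul_emb // lx0 Qs_emb0.
exists d => //; apply/eqP; rewrite -subr_eq0; apply/eqP.
elim/Qs_ind: c Cc c0 dP {cann} => p Cp p0 dP.
apply: (Qs_annr (sm_domP p)) => x px.
by rewrite mulrBl mul1r -mulrA Qs_mul_emb // (dP _ x) ?subrr // Qs_mul_emb.
Qed.

Lemma extended_centroid_emb x : C (emb x) -> rng_center R x.
Proof. by move=> Cx y; apply: Qs_emb_inj; rewrite !Qs_emb_mul Cx. Qed.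

(** * Martindale's argument for two inner derivations with zero composite on [I] *)

Section CommutingDerivations.
Variables (I : set R) (a b : R).
Hypothesis nI : nonzero_ideal I.
Hypothesis abI : forall x, I x -> rng_comm b (rng_comm a x) = 0.

Lemma commuting_derivations_mul x y : I x -> I y ->
  rng_comm a x ** rng_comm b y + rng_comm b x ** rng_comm a y = 0.
Proof.
move=> Ix Iy; have := abI (nI.1.2 x _ Iy).1.
have commD u v : rng_comm b (u + v) = rng_comm b u + rng_comm b v.
  by rewrite -rng_commN rng_commDl opprD !rng_commN.
by rewrite rng_commMr commD !rng_commMr !abI // rngmul0r rngmulr0 addr0 add0r.
Qed.

(** Put [zy] for [y] in the preceding identity; the terms ending in [y] cancel by that identity for
    [x] and [z]. *)
Lemma commuting_derivations_mid x y z : I x -> I y -> I z ->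
  rng_comm a x ** z ** rng_comm b y + rng_comm b x ** z ** rng_comm a y = 0.
Proof.
move=> Ix Iy Iz; have := commuting_derivations_mul Ix (nI.1.2 z _ Iy).1.
rewrite !rng_commMr !rngmulDr !rngmulA addrACA -!rngmulDl.
by rewrite commuting_derivations_mul // rngmul0r add0r.
Qed.

Lemma commuting_derivations_dependent : ~ rng_center R a ->
  exists c d, [/\ C c, C d & emb b = c * emb a + d].
Proof.
move=> na.
have [y Iy ay0] : exists2 y, I y & rng_comm a y <> 0.
  apply: contrapT => no; apply: na; apply: (ideal_centralizer nI) => x Ix.
  by apply: contrapT => ax; apply: no; exists x.
(* This relation pairs [[a, x]] with [[b, x]] for every [x] in [I]; it is single-valued because
   [[a, y]] is nonzero. *)
have [c Cc cP] : exists2 c, C c & forall u v,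
    (forall z, I z -> u ** z ** rng_comm b y + v ** z ** rng_comm a y = 0) ->
    c * emb u = emb v.
  apply: extended_centroid_graph.
  - by move=> z _; rewrite !rngmul0r addr0.
  - move=> u v u' v' uv uv' z Iz; rewrite !rngmulBl addrACA -opprD.
    by rewrite uv // uv' // subrr.
  - by move=> r u v uv z Iz; rewrite -!rngmulA -rngmulDr !rngmulA uv // rngmulr0.
  - move=> r u v uv z Iz; rewrite -(rngmulA u) -(rngmulA v); apply: uv.
    exact: (nI.1.2 _ _ Iz).1.
  - move=> v v0; have [//|//] : v = 0 \/ rng_comm a y = 0.
    by apply: (ideal_prime nI) => z /v0; rewrite !rngmul0r add0r.
  exists (rng_comm a y), (rng_comm b y); split; last exact/eqP.
  by move=> z Iz; apply: commuting_derivations_mid.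
exists c, (emb b - c * emb a); split=> //; last by rewrite addrC subrK.
apply: (extended_centroid_ideal nI) => x Ix.
have e : c * emb (rng_comm a x) = emb (rng_comm b x).
  by apply: cP => z Iz; apply: commuting_derivations_mid.
rewrite !Qs_emb_comm in e.
rewrite mulrBl mulrBr [emb x * (c * _)]mulrA -[emb x * c]Cc -!mulrA.
by apply/eqP; rewrite subr_eq addrAC -addrA -mulrBr e addrC subrK.
Qed.

End CommutingDerivations.

(** * Commutative [A] in characteristic 2 *)

Lemma char2_square_central I a : rng_char_eq R 2 -> nonzero_ideal I ->
  (forall x, I x -> rng_comm a (rng_comm a x) = 0) -> rng_center R (a ** a).
Proof.
move=> [_ c2 _] nI aaI.
have dbl u : u + u = 0 :> R by rewrite -mulr2n c2.
have N u : - u = u :> R by apply: (addrI u); rewrite subrr dbl.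
apply: (ideal_centralizer nI) => x Ix; rewrite -(aaI x Ix) /rng_comm.
rewrite rngmulBl rngmulBr !rngmulA !N addrA.
by rewrite -[in RHS](addrA (a ** a ** x)) dbl addr0.
Qed.

(** Otherwise [[a, x] = ca] and [[a, ax] = da], while [[a, ax] = a[a, x] = ca^2]. A nonzero [d]
    would put [a] in [C], so [a[a, x] = 0] throughout [I], and primeness makes [a] central. *)
Lemma comm_not_proportional I a : nonzero_ideal I -> ~ rng_center R a ->
    rng_center R (a ** a) ->
  exists2 x, I x & forall c, C c -> emb (rng_comm a x) <> c * emb a.
Proof.
move=> nI na aac; apply: contrapT => no.
have prop x : I x -> exists2 c, C c & emb (rng_comm a x) = c * emb a.
  move=> Ix; apply: contrapT => no'; apply: no; exists x => // c Cc xc.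
  by apply: no'; exists c.
have Caa : C (emb (a ** a)).
  by apply: (extended_centroid_ideal nI) => x Ix; rewrite -!Qs_emb_mul aac.
have aaI x : I x -> a ** rng_comm a x = 0.
  move=> Ix; have [c Cc cx] := prop x Ix.
  have [d Cd dx] := prop _ (nI.1.2 a _ Ix).1.
  have aax : rng_comm a (a ** x) = a ** rng_comm a x.
    by rewrite rng_commMr /rng_comm subrr rngmul0r add0r.
  have [d0|d0] := eqVneq d 0.
    by apply: Qs_emb_inj; rewrite -aax dx d0 mul0r Qs_emb0.
  have [e Ce ed] := extended_centroid_inv Cd d0.
  case: na; apply: extended_centroid_emb.
  rewrite -[emb a]mul1r -ed -mulrA -dx aax Qs_emb_mul cx.
  rewrite [emb a * _]mulrA -Cc -mulrA -Qs_emb_mul.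
  by do 2 apply: extended_centroidM => //.
apply: na; apply: (ideal_centralizer nI) => y Iy.
have [a0|//] : a = 0 \/ rng_comm a y = 0; last by rewrite a0 rng_comm0l.
(* Expanding [a[a, xy] = 0] leaves [a x [a, y] = 0]. *)
apply: (ideal_prime nI) => x Ix; have := aaI _ (nI.1.2 x _ Iy).1.
by rewrite rng_commMr rngmulDr !rngmulA aaI // rngmul0r add0r.
Qed.

Lemma commutative_central_span A I a : rng_char_eq R 2 -> additive_subgroup A ->
    nonzero_ideal I -> (forall a x, A a -> I x -> A (rng_comm a x)) ->
    (forall a b, A a -> A b -> rng_comm a b = 0) -> A a -> ~ rng_center R a ->
  rng_center R (a ** a) /\
  central_span A = [set q : Qs R | exists c d : Qs R,
    [/\ C c, C d & q = c * emb a + d]].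
Proof.
move=> c2 sA nI AI AA Aa na.
have aac : rng_center R (a ** a).
  by apply: (char2_square_central c2 nI) => x Ix; apply: AA => //; apply: AI.
have sC := extended_centroid_subgroup.
have dep b : A b -> exists c d, [/\ C c, C d & emb b = c * emb a + d].
  move=> Ab; apply: (commuting_derivations_dependent nI _ na) => x Ix.
  by apply: AA => //; apply: AI.
split=> //; apply/seteqP; split.
  apply: smallest_sub.
    split=> [|_ _ [c [d [Cc Cd ->]]] [c' [d' [Cc' Cd' ->]]]].
      by exists 0, 0; split; [exact: sC.1|exact: sC.1|rewrite mul0r addr0].
    exists (c - c'), (d - d'); split; [exact: sC.2|exact: sC.2|].
    by rewrite mulrBl opprD addrACA.
  move=> _ [_ [b Ab <-] [e Ce <-]]; have [c [d [Cc Cd ->]]] := dep b Ab.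
  exists (e * c), (e * d); split; [exact: extended_centroidM|exact: extended_centroidM|].
  by rewrite -Ce mulrDr mulrA.
have sV : additive_subgroup (central_span A) by exact: additive_span_subgroup.
have gen b c : A b -> C c -> central_span A (c * emb b).
  move=> Ab Cc; rewrite Cc => V [_ VG]; apply: VG.
  by exists (emb b); [exists b|exists c].
move=> _ [c [d [Cc Cd ->]]]; apply: (additive_subgroupD sV); first exact: gen.
have [x Ix xP] := comm_not_proportional nI na aac.
have Aax := AI _ _ Aa Ix; have [l [m [Cl Cm lm]]] := dep _ Aax.
have m0 : m != 0 by apply/eqP => m0; apply: (xP l Cl); rewrite lm m0 addr0.
have [e Ce em] := extended_centroid_inv Cm m0.
(* From [[a, x] = la + m] and [em = 1], [d = de([a, x] - la)] is a [C]-combination of two elements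
   of [A]. *)
have -> : d = d * e * emb (rng_comm a x) - d * e * l * emb a.
  by rewrite -[X in _ - X]mulrA -mulrBr lm addrC addKr -mulrA em mulr1.
have Cde := extended_centroidM Cd Ce.
by apply: sV.2; apply: gen => //; exact: extended_centroidM.
Qed.

End PrimeRings.

Theorem theorem4p7 (R : primeRngType) (excR : exceptional R) (A I : set R)
    (subgA : additive_subgroup A) (noncentralA : ~ (A `<=` rng_center R))
    (idealI : nonzero_ideal I) (AI : comm_span A I `<=` A) :
  (exists2 L : set R, proper_lie_ideal L & L `<=` A) \/
  (exists a : R,
    [/\ A a, ~ rng_center R a, rng_center R (a ** a)
      & central_span A = [set q : Qs R | exists c d : Qs R,
          [/\ extended_centroid R c, extended_centroid R d
            & q = c * Qs_emb a + d]]]).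
Proof.
have {}AI a x : A a -> I x -> A (rng_comm a x) by apply/comm_spanP: a x.
have [[a [b [Aa Ab ab0]]]|AA] := EM (exists a b, [/\ A a, A b & rng_comm a b != 0]).
  by left; exact: (noncommutative_contains_proper_lie_ideal subgA idealI AI Aa Ab ab0).
right.
(* In the commutative case any noncentral element of [A] serves as [a]. *)
have [a Aa na] : exists2 a, A a & ~ rng_center R a.
  apply: contrapT => no; apply: noncentralA => a Aa; apply: contrapT => na.
  by apply: no; exists a.
have comA b c : A b -> A c -> rng_comm b c = 0.
  by move=> Ab Ac; apply: contrapT => /eqP bc; apply: AA; exists b, c.
have [aac spanA] := commutative_central_span excR.1 subgA idealI AI comA Aa na.
by exists a.
Qed.
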